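(* If $\mathbf{x}$ is an infinite binary word that is $2$-pseudoperiodic, then $\mathbf{x}$ contains a $(7/3)$-power, i.e., $\mathbf{x}$ has a nonempty finite factor $y$ with $\exp(y)\ge 7/3$.
   Context: For integers $0<p_1<p_2$, an infinite word $\mathbf{x}$ (indexed from $0$) has pseudoperiod $(p_1,p_2)$ if $\mathbf{x}[i]\in\{\mathbf{x}[i+p_1],\mathbf{x}[i+p_2]\}$ for all $i\ge0$; it is $2$-pseudoperiodic if it has some such pseudoperiod. The exponent of a nonempty finite word $y$ is $\exp(y)=|y|/p$ where $p$ is the smallest period of $y$ (the least $p\ge1$ with $y[i]=y[i+p]$ for all $0\le i<|y|-p$). *)

(* Defs.v *)
From mathcomp Require Import all_boot all_order all_algebra.

Set Implicit Arguments.
Unset Strict Implicit.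
Unset Printing Implicit Defensive.

Import Order.TTheory GRing.Theory Num.Theory.

Definition infword (T : Type) := nat -> T.

Definition has_pseudoperiod2 (T : Type) (x : infword T) (p1 p2 : nat) : Prop :=
  forall i : nat, x i = x (i + p1) \/ x i = x (i + p2).

Definition pseudoperiodic2 (T : Type) (x : infword T) : Prop :=
  exists p1 p2 : nat, 0 < p1 /\ p1 < p2 /\ has_pseudoperiod2 x p1 p2.

Definition is_factor (T : Type) (y : seq T) (x : infword T) : Prop :=
  exists i : nat, y = mkseq (fun k => x (i + k)) (size y).

(* Both indices are in range below, so [onth] never compares a [None]; when
   [size y <= p] the truncated subtraction makes the condition vacuous. *)
Definition is_period (T : eqType) (y : seq T) (p : nat) : bool :=
  (0 < p) && [forall i : 'I_(size y - p), onth y i == onth y (i + p)].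

Lemma is_period_ex (T : eqType) (y : seq T) : exists p, is_period y p.
Proof.
exists (size y).+1; apply/andP; split=> //; apply/forallP => -[i /= lti].
by exfalso; move: lti; rewrite (eqP (leqnSn (size y))).
Qed.

Definition min_period (T : eqType) (y : seq T) : nat := ex_minn (is_period_ex y).

Definition word_exp (T : eqType) (y : seq T) : rat :=
  ((size y)%:R / (min_period y)%:R)%R.

(* Main.v *)
Require Import Defs.
From mathcomp Require Import all_boot all_order all_algebra.
From mathcomp Require Import zify.
From Stdlib Require Import Classical_Prop.

(** A binary word avoiding (7/3)-powers has a tail which is the image of another
    such word [y] under the Thue-Morse morphism [0 -> 01, 1 -> 10].  If both
    pseudoperiods are even, halving them gives pseudoperiods of [y], and one
    descends.  Otherwise, desubstituting [y] once more turns the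
    pseudoperiodicity into an identity [z (j + c) = z (j + d)] with [c != d], or
    [z (j + c) = ~~ z (j + d)], valid for all [j]; so [z] is ultimately periodic
    and contains arbitrarily high powers. *)

Set Implicit Arguments.
Unset Strict Implicit.
Unset Printing Implicit Defensive.

Import Order.TTheory GRing.Theory Num.Theory.

Section PowerFree.

Variable T : eqType.
Implicit Types (x y : infword T) (w : seq T) (e : rat).

Definition power_free e x : Prop :=
  forall w, w <> [::] -> is_factor w x -> (word_exp w < e)%R.

Definition periodic_on x i n p : Prop :=
  forall k, k + p < n -> x (i + k) = x (i + k + p).

Definition is_tail y x : Prop := exists s, forall n, y n = x (s + n).

Lemma min_periodP w :
  is_period w (min_period w) /\ forall p, is_period w p -> min_period w <= p.
Proof. by rewrite /min_period; case: ex_minnP. Qed.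

Lemma le_word_exp w p :
  is_period w p -> ((size w)%:R / p%:R <= word_exp w)%R.
Proof.
move=> per; have [/andP[m0 _] /(_ p per) le_mp] := min_periodP w.
have /andP[p0 _] := per.
by rewrite ler_wpM2l ?ler0n // lef_pV2 ?posrE ?ltr0n // ler_nat.
Qed.

Lemma is_period_mkseqP x i n p : 0 < p ->
  reflect (periodic_on x i n p) (is_period (mkseq (fun k => x (i + k)) n) p).
Proof.
move=> p0; rewrite /is_period p0 size_mkseq.
have onth_x k : k < n ->
    onth (mkseq (fun k => x (i + k)) n) k = Some (x (i + k)).
  by move=> ltkn; rewrite onthE -map_comp (nth_map 0) ?size_iota ?nth_iota.
apply: (iffP forallP) => [per k ltk | per [k ltk] /=].
  have ltk' : k < n - p by lia.
  have /eqP := per (Ordinal ltk'); rewrite /= !onth_x ?addnA; try lia.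
  by case.
by rewrite !onth_x ?addnA ?per //; lia.
Qed.

Lemma power_freeP e x :
  power_free e x <-> forall i n p, 0 < p -> 0 < n ->
    periodic_on x i n p -> (n%:R < e * p%:R)%R.
Proof.
split=> [fx i n p p0 n0 /(is_period_mkseqP _ _ _ p0) per | bound w w0].
  have := le_word_exp per; rewrite size_mkseq -ltr_pdivrMr ?ltr0n //.
  move=> /le_lt_trans; apply; apply: fx.
    by move/(congr1 size); rewrite size_mkseq /=; lia.
  by exists i; rewrite size_mkseq.
case=> i def_w.
have [per _] := min_periodP w; have /andP[m0 _] := per.
rewrite ltr_pdivrMr ?ltr0n //; apply: (bound i) => //.
  by case: w w0 {def_w per m0}.
by apply/is_period_mkseqP; rewrite -?def_w.
Qed.

Lemma power_free_tail e x y : is_tail y x -> power_free e x -> power_free e y.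
Proof.
case=> s yx /power_freeP fx; apply/power_freeP => i n p p0 n0 per.
by apply: (fx (s + i)) => // k /per; rewrite !yx !addnA.
Qed.

Lemma power_free_not_periodic e x c d : power_free e x -> c <> d ->
  ~ (forall j, x (j + c) = x (j + d)).
Proof.
move=> /power_freeP fx; wlog lt_cd : c d / c < d => [wlog_lt | _] cd.
  have [lt|le] := ltnP c d; first exact: (wlog_lt c d).
  by move=> per; apply: (wlog_lt d c) => //; lia.
pose n := (Num.truncn e).+1 * (d - c).
have per : periodic_on x c n (d - c).
  by move=> k _; rewrite addnC cd; congr x; lia.
have := fx c n (d - c); rewrite subn_gt0 muln_gt0 subn_gt0 lt_cd /n natrM.
move/(_ isT isT per); rewrite ltr_pM2r ?ltr0n ?subn_gt0 //.
by rewrite ltNge (ltW (truncnS_gt e)).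
Qed.

Lemma has_pseudoperiod2_sym x p q :
  has_pseudoperiod2 x p q -> has_pseudoperiod2 x q p.
Proof. by move=> pp i; case: (pp i); auto. Qed.

Lemma has_pseudoperiod2_tail x y p q :
  is_tail y x -> has_pseudoperiod2 x p q -> has_pseudoperiod2 y p q.
Proof. by case=> s yx pp i; rewrite !yx !addnA; apply: pp. Qed.

Definition has_antiperiod2 x a b : Prop :=
  forall i, (x i != x (i + a)) || (x i != x (i + b)).

Lemma has_antiperiod2_sym x a b :
  has_antiperiod2 x a b -> has_antiperiod2 x b a.
Proof. by move=> ap i; rewrite orbC. Qed.

Lemma has_antiperiod2_tail x y a b :
  is_tail y x -> has_antiperiod2 x a b -> has_antiperiod2 y a b.
Proof. by case=> s yx ap i; rewrite !yx !addnA; apply: ap. Qed.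

Definition repeat_at x n : bool := x n == x n.+1.

End PowerFree.

Lemma power_free_not_twisted_periodic e (x : infword bool) c d b :
  power_free e x -> b || (c != d) -> ~ (forall j, x (j + c) = b (+) x (j + d)).
Proof.
move=> fx; case: b => /= [_ anti | /eqP cd]; last first.
  exact: power_free_not_periodic fx cd.
have [cd | /eqP cd] := eqVneq c d.
  by have := anti 0; rewrite cd; case: (x _).
apply: (@power_free_not_periodic _ _ _ (c + c) (d + d) fx) => [|j]; first lia.
by rewrite addnA anti addnAC anti negbK addnA.
Qed.

Lemma not_repeat_atP (x : infword bool) n :
  reflect (x n.+1 = ~~ x n) (~~ repeat_at x n).
Proof. by rewrite /repeat_at; case: (x n) (x n.+1) => [] []; constructor. Qed.

Definition thue_morse (y : infword bool) : infword bool :=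
  fun n => odd n (+) y n./2.

Section ThueMorse.

Implicit Types (x y : infword bool) (e : rat).

Lemma thue_morseD y i n : thue_morse y (i.*2 + n) = odd n (+) y (i + n./2).
Proof. by rewrite /thue_morse oddD halfD odd_double doubleK. Qed.

Lemma thue_morse_double y i : thue_morse y i.*2 = y i.
Proof. by rewrite -[i.*2]addn0 thue_morseD addn0. Qed.

Lemma thue_morse_doubleS y i : thue_morse y i.*2.+1 = ~~ y i.
Proof. by rewrite -addn1 thue_morseD addn0. Qed.

Lemma thue_morse_no_repeat_at y i : ~~ repeat_at (thue_morse y) i.*2.
Proof.
by apply/not_repeat_atP; rewrite thue_morse_double thue_morse_doubleS.
Qed.

Lemma thue_morse_tail x s : (forall m, ~~ repeat_at x (s + m.*2)) ->
  is_tail (thue_morse (fun m => x (s + m.*2))) x.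
Proof.
move=> alt; exists s => n; rewrite /thue_morse -{3}(odd_double_half n).
by case: (odd n) => //=; rewrite addnS (not_repeat_atP _ _ (alt _)).
Qed.

Lemma periodic_on_thue_morse y i n p :
  periodic_on y i n p -> periodic_on (thue_morse y) i.*2 n.*2 p.*2.
Proof.
move=> per k ltk; rewrite -addnA !thue_morseD oddD odd_double addbF.
by rewrite halfD odd_double andbF doubleK add0n addnA -per //; lia.
Qed.

Lemma power_free_thue_morse e y : power_free e (thue_morse y) -> power_free e y.
Proof.
move=> /power_freeP fy; apply/power_freeP => i n p p0 n0.
move/periodic_on_thue_morse/fy; rewrite !double_gt0 => /(_ p0 n0).
by rewrite -!muln2 !natrM mulrA ltr_pM2r.
Qed.

End ThueMorse.

Local Notation power73_free := (power_free (7%:R / 3%:R)%R).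

Lemma power73_free_periodic (T : eqType) (x : infword T) i n p :
  power73_free x -> periodic_on x i n p -> 0 < p -> 3 * n < 7 * p.
Proof.
move=> /power_freeP fx per p0; have [-> |n0] := posnP n; first lia.
have := fx _ _ _ p0 n0 per; rewrite mulrAC ltr_pdivlMr ?ltr0n //.
by rewrite -!natrM ltr_nat mulnC.
Qed.

Lemma repeat_atS (T : eqType) (x : infword T) n :
  power73_free x -> repeat_at x n -> ~~ repeat_at x n.+1.
Proof.
move=> fx /eqP x01; apply/negP => /eqP x12.
have per : periodic_on x n 3 1.
  by case=> [|[|k]] //; rewrite !addnS !addn0.
by have := power73_free_periodic fx per isT.
Qed.

Section Desubstitution.

Variables (x : infword bool) (fx : power73_free x).

(* Two repeats at distance 3 form [aabaa] with [b = ~~ a], and the letters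
   around it must be [b], which makes the (7/3)-power [baabaab]. *)
Lemma repeat_at_add3 n : repeat_at x n.+1 -> ~~ repeat_at x n.+4.
Proof.
move=> rep1; apply/negP => rep4.
have /not_repeat_atP x3 := repeat_atS fx rep1.
have /not_repeat_atP x6 := repeat_atS fx rep4.
have /not_repeat_atP x1 : ~~ repeat_at x n.
  by apply: contraL rep1 => /(repeat_atS fx).
have /not_repeat_atP x4 : ~~ repeat_at x n.+3.
  by apply: contraL rep4 => /(repeat_atS fx).
move/eqP in rep1; move/eqP in rep4.
have per : periodic_on x n 7 3.
  case=> [|[|[|[|k]]]] //; rewrite !addnS !addn0;
    by rewrite ?x6 -?rep4 ?x4 ?x3 -?rep1 ?x1 ?negbK.
by have := power73_free_periodic fx per isT.
Qed.

Lemma has_repeat_at n : has (repeat_at x) (iota n 4).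
Proof.
rewrite -[has _ _]negbK -all_predC /=; apply/negP.
case/and5P=> /not_repeat_atP x1 /not_repeat_atP x2 /not_repeat_atP x3.
move=> /not_repeat_atP x4 _.
have per : periodic_on x n 5 2.
  by case=> [|[|[|k]]] //; rewrite !addnS !addn0 ?x4 ?x3 ?x2 ?x1 ?negbK.
by have := power73_free_periodic fx per isT.
Qed.

Lemma repeat_at_same_parity m n :
  repeat_at x m -> repeat_at x n -> 0 < m -> 0 < n -> odd m = odd n.
Proof.
wlog le_mn : m n / m <= n => [wlog_le rep_m rep_n m0 n0 | rep_m rep_n m0 _].
  have [|/ltnW] := leqP m n; first by move=> le_mn; apply: wlog_le.
  by move=> le_nm; apply: esym; apply: wlog_le.
have [d] := ubnP (n - m).
elim: d m le_mn rep_m m0 => // d IH m le_mn rep_m m0 lt_d.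
have gap k : repeat_at x k -> (k != m.+1) && (k != m.+3).
  move=> rep_k; apply/andP; split; apply: contraTneq rep_k => ->.
    exact: repeat_atS.
  by rewrite -(prednK m0) in rep_m *; apply: repeat_at_add3.
have gap_n := gap n rep_n.
have /hasP[k] := has_repeat_at m.+1; rewrite mem_iota => le_k rep_k.
have gap_k := gap k rep_k.
have [lt_nk | le_kn] := ltnP n k; first lia.
have -> : odd m = odd k by lia.
by apply: IH => //; lia.
Qed.

Lemma desubstitution : exists2 y, is_tail (thue_morse y) x & power73_free y.
Proof.
have /hasP[n] := has_repeat_at 1; rewrite mem_iota => /andP[n0 _] rep_n.
have alternating m : ~~ repeat_at x (n.+1 + m.*2).
  apply/negP => rep_m; have := repeat_at_same_parity rep_n rep_m n0 isT.
  by rewrite oddD odd_double /=; case: (odd n).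
have tail_y := thue_morse_tail alternating.
exists (fun m => x (n.+1 + m.*2)) => //.
exact: power_free_thue_morse (power_free_tail tail_y fx).
Qed.

End Desubstitution.

Section OddPseudoperiod.

Implicit Types y z : infword bool.

Lemma thue_morse_pseudoperiod2_odd_even_repeat_at y p q i :
  odd p -> ~~ odd q -> has_pseudoperiod2 (thue_morse y) p q ->
  y i != y (i + q./2) -> repeat_at y (i + p./2).
Proof.
move=> odd_p even_q pp; have := pp i.*2; have := pp i.*2.+1.
rewrite !addSnnS !thue_morseD thue_morse_double thue_morse_doubleS /=.
rewrite !uphalf_half odd_p (negbTE even_q) add0n add1n addnS /repeat_at.
by case: (y i); case: (y (i + p./2)); case: (y (i + q./2));
  case: (y (i + p./2).+1) => -[] // _ [].
Qed.

Lemma thue_morse_not_pseudoperiod2_odd_even y p q :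
  power73_free y -> odd p -> ~~ odd q -> 0 < q ->
  ~ has_pseudoperiod2 (thue_morse y) p q.
Proof.
move=> fy odd_p even_q q0 pp.
have [z [t zy] fz] := desubstitution fy.
have periodic_even_block i : ~~ odd (i + p./2) ->
    thue_morse z i = thue_morse z (i + q./2).
  move=> even_ip; apply/eqP/negPn/negP; rewrite !zy addnA.
  move/(thue_morse_pseudoperiod2_odd_even_repeat_at odd_p even_q pp).
  have := thue_morse_no_repeat_at z (i + p./2)./2.
  by rewrite even_halfK // /repeat_at !zy addnS addnA => /negP.
pose r := odd p./2.
apply: (@power_free_not_twisted_periodic _ z 0 (r + q./2)./2 (odd q./2) fz).
  by have [//|even_half_q /=] := boolP (odd q./2); lia.
move=> j; have : thue_morse z (j.*2 + r) = thue_morse z (j.*2 + (r + q./2)).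
  rewrite addnA; apply: periodic_even_block.
  by rewrite !oddD odd_double oddb addbb.
have half_r : r./2 = 0 by case: r.
by rewrite !thue_morseD oddD half_r -addbA => /addbI.
Qed.

Lemma thue_morse_pseudoperiod2_odd_antiperiod2 y p q :
  odd p -> odd q -> has_pseudoperiod2 (thue_morse y) p q ->
  has_antiperiod2 y p./2 q./2 /\ has_antiperiod2 y p./2.+1 q./2.+1.
Proof.
move=> odd_p odd_q pp; split=> i.
  have := pp i.*2; rewrite !thue_morseD thue_morse_double odd_p odd_q.
  by case: (y i); case: (y _); case: (y _) => -[].
have := pp i.*2.+1; rewrite !addSnnS !thue_morseD thue_morse_doubleS /=.
rewrite !uphalf_half odd_p odd_q.
by case: (y i); case: (y _); case: (y _) => -[].
Qed.

Lemma thue_morse_not_antiperiod2_same_parity e z a b :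
  power_free e z -> odd a = odd b -> has_antiperiod2 (thue_morse z) a b ->
  ~ has_antiperiod2 (thue_morse z) a.+1 b.+1.
Proof.
move=> fz odd_ab ap apS.
apply: (@power_free_not_twisted_periodic _ z (uphalf a) (uphalf b) true fz).
  by [].
move=> j.
have rounds_up n : (odd n + n)./2 = uphalf n by lia.
have half_odd_a : (odd a)./2 = 0 by case: (odd a).
have := ap (j.*2 + odd a); have := apS j.*2.
rewrite -!addnA !thue_morseD thue_morse_double /= !oddD !oddb half_odd_a addn0.
rewrite rounds_up odd_ab rounds_up addbb /=.
by case: (odd b); case: (z j); case: (z _); case: (z _).
Qed.

Lemma thue_morse_antiperiod2_even_odd_periodic z a b :
  ~~ odd a -> odd b -> has_antiperiod2 (thue_morse z) a b ->
  has_antiperiod2 (thue_morse z) a.+1 b.+1 ->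
  forall j, z (j + a./2) = z (j + uphalf b).
Proof.
move=> /negbTE even_a odd_b ap apS j.
have := ap j.*2.+1; have := apS j.*2.
rewrite !addSnnS !thue_morseD thue_morse_double thue_morse_doubleS /=.
rewrite even_a odd_b [uphalf a]uphalf_half even_a.
by case: (z j); case: (z (j + a./2)); case: (z (j + uphalf b)).
Qed.

Lemma thue_morse_not_antiperiod2_even_odd z a b :
  power73_free z -> ~~ odd a -> odd b -> has_antiperiod2 (thue_morse z) a b ->
  ~ has_antiperiod2 (thue_morse z) a.+1 b.+1.
Proof.
move=> fz even_a odd_b ap apS.
have periodic := thue_morse_antiperiod2_even_odd_periodic even_a odd_b ap apS.
have ab : a./2 = b./2.+1.
  have [->|/eqP neq_ab] := eqVneq a./2 (uphalf b).
    by rewrite uphalf_half odd_b.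
  by case: (power_free_not_periodic fz neq_ab).
(* The identity [periodic] is void, but [z j = z (j + a./2)] would make the
   three letters of [z] at [j + b./2] equal. *)
apply: (@power_free_not_twisted_periodic _ z 0 a./2 true fz) => // j.
rewrite addn0.
have [eq_j | ] := eqVneq (z j) (z (j + a./2)); last by case: (z j); case: (z _).
have rep_b : repeat_at z (j + b./2).
  have := ap j.*2; rewrite !thue_morseD thue_morse_double.
  rewrite odd_b (negbTE even_a) /= -eq_j eqxx /repeat_at -addnS -ab -eq_j.
  by case: (z j); case: (z _).
have rep_bS : repeat_at z (j + b./2).+1.
  have := apS j.*2.+1; rewrite !addSnnS !thue_morseD thue_morse_doubleS /=.
  rewrite odd_b (negbTE even_a) /repeat_at -!addnS -ab -eq_j.
  by case: (z j); case: (z _).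
by have := repeat_atS fz rep_b; rewrite rep_bS.
Qed.

Lemma thue_morse_not_pseudoperiod2_odd_odd y p q :
  power73_free y -> odd p -> odd q -> ~ has_pseudoperiod2 (thue_morse y) p q.
Proof.
move=> fy odd_p odd_q pp.
have [z tail_z fz] := desubstitution fy.
have [/(has_antiperiod2_tail tail_z) ap /(has_antiperiod2_tail tail_z) apS] :=
  thue_morse_pseudoperiod2_odd_antiperiod2 odd_p odd_q pp.
have [odd_a | even_a] := boolP (odd p./2);
  have [odd_b | even_b] := boolP (odd q./2).
- by apply: thue_morse_not_antiperiod2_same_parity fz _ ap apS; rewrite odd_a.
- have {}ap := has_antiperiod2_sym ap; have {}apS := has_antiperiod2_sym apS.
  exact: thue_morse_not_antiperiod2_even_odd fz even_b odd_a ap apS.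
- exact: thue_morse_not_antiperiod2_even_odd fz even_a odd_b ap apS.
- apply: thue_morse_not_antiperiod2_same_parity fz _ ap apS.
  by rewrite (negbTE even_a) (negbTE even_b).
Qed.

End OddPseudoperiod.

Lemma thue_morse_pseudoperiod2_half y p q : ~~ odd p -> ~~ odd q ->
  has_pseudoperiod2 (thue_morse y) p q -> has_pseudoperiod2 y p./2 q./2.
Proof.
move=> /negbTE even_p /negbTE even_q pp i.
by have := pp i.*2; rewrite !thue_morseD thue_morse_double even_p even_q.
Qed.

Lemma power73_free_not_pseudoperiod2 (x : infword bool) p q :
  0 < p -> 0 < q -> power73_free x -> ~ has_pseudoperiod2 x p q.
Proof.
elim/ltn_ind: p q x => p IH q x p0 q0 fx pp.
have [y tail_y fy] := desubstitution fx.
have {}pp := has_pseudoperiod2_tail tail_y pp.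
have [odd_p | even_p] := boolP (odd p); have [odd_q | even_q] := boolP (odd q).
- exact: thue_morse_not_pseudoperiod2_odd_odd fy odd_p odd_q pp.
- exact: thue_morse_not_pseudoperiod2_odd_even fy odd_p even_q q0 pp.
- have {}pp := has_pseudoperiod2_sym pp.
  exact: thue_morse_not_pseudoperiod2_odd_even fy odd_q even_p p0 pp.
- have half_pp := thue_morse_pseudoperiod2_half even_p even_q pp.
  by apply: (IH p./2 _ q./2 y) half_pp => //; lia.
Qed.

Theorem theorem30 (x : infword bool) (hx : pseudoperiodic2 x) :
  exists y : seq bool,
    y <> [::] /\ is_factor y x /\ (7%:R / 3%:R <= word_exp y)%R.
Proof.
have [p [q [p0 [lt_pq pp]]]] := hx.
have q0 : 0 < q := ltn_trans p0 lt_pq.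
apply: NNPP => no_power.
suff fx : power73_free x by exact: power73_free_not_pseudoperiod2 p0 q0 fx pp.
move=> w w0 factor_w; rewrite ltNge; apply/negP => exp_w.
by apply: no_power; exists w.
Qed.
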